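(* Let $k,\ell$ be coprime integers with $k>\ell\geqslant 1$, let $A(z),B(z)\in\mathbb{C}[z]$ be non-zero polynomials with $\deg(A(z)B(z))\geqslant 1$, and let $\{P_n(z)\}_{n\geqslant 0}$ be the polynomial sequence defined by $$P_n(z)+B(z)P_{n-\ell}(z)+A(z)P_{n-k}(z)=0\quad (n\geqslant 1),\qquad P_0(z)=1,\quad P_{-1}(z)=\cdots=P_{1-k}(z)=0.$$ Let $z_0\in\mathcal{Z}_{\{P_n(z)\}}-\mathcal{Z}_{A(z)}$, i.e. $z_0$ is a zero of some polynomial $P_n(z)$ that is not identically zero, and $A(z_0)\neq 0$. Then there exist at least two zeros (counted with multiplicity) of the trinomial $D(t;z_0)=A(z_0)t^k+B(z_0)t^{\ell}+1$, a polynomial in $t$, whose ratio is real and/or has modulus $1$. That is, if $t_1,\ldots,t_k$ are the zeros of $D(t;z_0)$ listed with multiplicity, then there are indices $i\neq j$ with $t_i/t_j\in\mathbb{R}$ or $|t_i/t_j|=1$.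
   Context: For a non-zero polynomial $f$, $\mathcal{Z}_{f(z)}$ is the set of complex zeros of $f$; for a non-empty set $\mathcal{X}$ of non-zero complex polynomials, $\mathcal{Z}_{\mathcal{X}}=\bigcup_{f\in\mathcal{X}}\mathcal{Z}_{f(z)}$. $\mathcal{Z}_{\{P_n(z)\}}$ is the union of the zero sets of those $P_n(z)$ that are not identically zero. All zeros of $D(t;z_0)$ are non-zero since $D(0;z_0)=1$. *)

(* Defs.v *)
From mathcomp Require Import all_boot all_order all_algebra.
From mathcomp Require Import complex.
From mathcomp Require Import classical_sets reals.

Set Implicit Arguments.
Unset Strict Implicit.
Unset Printing Implicit Defensive.

Import Order.TTheory GRing.Theory Num.Theory.

Local Open Scope ring_scope.
Local Open Scope classical_set_scope.

(* The sequence is indexed by int so that the initial values P_(1-k), ..., P_(-1)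
   are genuine terms; the values at indices below 1 - k are unconstrained and
   never used by the recurrence. *)
Definition trinomial_recurrence (C : comNzRingType) (k l : nat)
    (A B : {poly C}) (P : int -> {poly C}) : Prop :=
  [/\ forall n : int, 1 <= n -> P n + B * P (n - l%:Z) + A * P (n - k%:Z) = 0,
      P 0 = 1
    & forall m : int, 1 - k%:Z <= m <= -1 -> P m = 0].

Definition zeros (C : nzRingType) (f : {poly C}) : set C := [set z | root f z].

Definition zeros_of_family (C : nzRingType) (X : set {poly C}) : set C :=
  \bigcup_(f in X) zeros f.

Definition zeros_of_sequence (C : nzRingType) (P : int -> {poly C}) : set C :=
  zeros_of_family [set f | f != 0 /\ exists2 n : int, 0 <= n & f = P n].

Definition denominator (C : nzRingType) (k l : nat) (A B : {poly C}) (z0 : C) :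
    {poly C} :=
  A.[z0] *: 'X^k + B.[z0] *: 'X^l + 1.

(* mup x p is a meaningful multiplicity only for p != 0. *)
Definition lists_zeros (C : fieldType) (t : seq C) (p : {poly C}) : Prop :=
  forall x : C, count_mem x t = mup x p.

(* Main.v *)
(* Write a = - A(z0), b = - B(z0).  If b = 0, the zeros of D all have the same
   modulus.  Otherwise put w = a^l / b^k.
   If w is real, coprimality of k and l yields s of modulus 1 such that
   x |-> s * conj x permutes the zeros of D: a zero that moves gives a ratio of
   modulus 1, and two fixed zeros have a real ratio.
   If w is not real, say 0 < arg w < pi, rescaling t turns the recurrence into
   u_n = u_(n-l) + r e^(i c) u_(n-k) with r > 0 and l c = arg w.  Its terms can be
   given arguments phi_n with phi_(n-l) <= phi_n <= phi_(n-k) + c; these two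
   inequalities keep the two summands within an angle l c < pi of one another,
   so they never cancel.  Hence P_n(z0) = 0 only if
   P_n = 0 identically. *)

Require Import Defs.
From mathcomp Require Import all_boot all_order all_algebra.
From mathcomp Require Import complex.
From mathcomp Require Import classical_sets reals.
From mathcomp Require Import trigo exp ring lra zify.

Import Order.TTheory GRing.Theory Num.Theory.

Local Open Scope ring_scope.
Local Open Scope classical_set_scope.
Local Open Scope complex_scope.

(** With $uk+vl=1$ the witness is $y^v x^u$; $u$ or $v$ may be negative, hence integer powers and
    non-zero bases. *)
Lemma coprime_exp_eq {F : fieldType} {k l : nat} {x y : F} :
  coprime k l -> x != 0 -> y != 0 -> x ^+ l = y ^+ k ->
  exists z, x = z ^+ k /\ y = z ^+ l.
Proof.
move=> kl x0 y0 xy; have [u [v uv]] := Bezoutz k%:Z l%:Z.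
have {}uv : u * k%:Z + v * l%:Z = 1 by rewrite uv /gcdz /= (eqP kl).
have {}xy : x ^ l%:Z = y ^ k%:Z by rewrite -!exprnP.
have swap z m (n : nat) : (z ^ m) ^+ n = (z ^ n%:Z) ^ m :> F.
  by rewrite exprnP !exprz_exp mulrC.
exists (y ^ v * x ^ u); rewrite !exprMn !swap; split.
- by rewrite -xy !exprz_exp -expfzDr// addrC [_ * u]mulrC [_ * v]mulrC uv expr1z.
- by rewrite xy !exprz_exp -expfzDr// addrC [_ * u]mulrC [_ * v]mulrC uv expr1z.
Qed.

(** * Polar form in the upper half-plane and sums inside a cone *)

Section Polar.
Context {R : realType}.
Implicit Types (r x y : R) (w : R[i]).

Definition cis x : R[i] := cos x +i* sin x.

Lemma cis0 : cis 0 = 1.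
Proof. by rewrite /cis cos0 sin0. Qed.

Lemma cisD x y : cis (x + y) = cis x * cis y.
Proof.
rewrite /cis cosD sinD; apply/eqP; rewrite eq_complex /=.
by rewrite [sin x * cos y + _]addrC !eqxx.
Qed.

Lemma cisMn x n : cis (x *+ n) = cis x ^+ n.
Proof.
by elim: n => [|n IH]; rewrite ?mulr0n ?cis0 // mulrS cisD IH exprS.
Qed.

Lemma cis_neq0 x : cis x != 0.
Proof.
apply/eqP => c0; have := cisD x (- x); rewrite addrN cis0 c0 mul0r => /eqP.
by rewrite oner_eq0.
Qed.

(** [acos] takes values in $[0,\pi]$, where the sine is non-negative, so it recovers the argument on
    the closed upper half-plane. *)
Lemma polar_upper {w} : 0 <= complex.Im w ->
  exists r x, [/\ 0 <= r, 0 <= x <= pi & w = r%:C * cis x].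
Proof.
case: w => a b /= b0; set r := Num.sqrt (a ^+ 2 + b ^+ 2).
have s0 : 0 <= a ^+ 2 + b ^+ 2 by rewrite addr_ge0 ?sqr_ge0.
have r2 : r ^+ 2 = a ^+ 2 + b ^+ 2 by rewrite sqr_sqrtr.
have := sqrtr_ge0 (a ^+ 2 + b ^+ 2); rewrite -/r le_eqVlt => /orP[/eqP r0|r0].
  exists 0, 0; split; rewrite ?lexx ?pi_ge0//.
  move: r2; rewrite -r0 expr0n /= => /esym/eqP.
  rewrite paddr_eq0 ?sqr_ge0// !sqrf_eq0 => /andP[/eqP-> /eqP->].
  by rewrite mul0r.
have ar : -1 <= a / r <= 1.
  rewrite ler_pdivrMr// ler_pdivlMr// mul1r mulN1r -ler_norml.
  rewrite -[leRHS]ger0_norm ?(ltW r0)// -ler_sqr ?nnegrE//.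
  by rewrite !real_normK ?num_real// r2 lerDl sqr_ge0.
exists r, (acos (a / r)); split; first exact: ltW.
  by rewrite acos_ge0 ?acos_lepi.
rewrite /cis sin_acos// acosK ?in_itv//=.
have -> : 1 - (a / r) ^+ 2 = (b / r) ^+ 2.
  rewrite !exprMn !exprVn r2; field.
  by rewrite -r2 expf_eq0 /= gt_eqF.
rewrite sqrtr_sqr ger0_norm ?(divr_ge0 b0 (ltW r0))//.
by apply/eqP; rewrite eq_complex /=; apply/andP; split; apply/eqP; field; rewrite gt_eqF.
Qed.

(** Rotating by $-x$ puts the sum in the closed upper half-plane, where [polar_upper] supplies its
    angle $t$. If $t>d=y-x$, the identity $r\sin(t-d)=-r_1\sin d$ clashes with the signs of the
    sines. *)
Lemma cone_angle {r1 r2 x y} : 0 <= r1 -> 0 <= r2 -> x <= y -> y < x + pi ->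
  exists r t, [/\ 0 <= r, x <= t <= y, r1%:C * cis x + r2%:C * cis y = r%:C * cis t
    & r = 0 -> r1 = 0 /\ r2 = 0].
Proof.
move=> r10 r20 xy yx; pose d := y - x.
have d0 : 0 <= d by rewrite /d; lra.
have dpi : d < pi by rewrite /d; lra.
have sd0 : 0 <= sin d by apply: sin_ge0_pi; rewrite d0 ltW.
pose w := r1%:C + r2%:C * cis d.
have wE : w = (r1 + r2 * cos d) +i* (r2 * sin d).
  by apply/eqP; rewrite eq_complex /=; apply/andP; split; apply/eqP; ring.
have imw : 0 <= complex.Im w by rewrite wE /= mulr_ge0.
have [r [t [r0 /andP[t0 tpi] wr]]] := polar_upper imw.
have [re im] : r * cos t = r1 + r2 * cos d /\ r * sin t = r2 * sin d.
  have := wr; rewrite wE => /eqP; rewrite eq_complex /= => /andP[/eqP-> /eqP->].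
  by split; ring.
have sumE : r1%:C * cis x + r2%:C * cis y = cis x * w.
  have -> : y = x + d by rewrite /d; ring.
  by rewrite cisD /w; ring.
have [rz|rn0] := eqVneq r 0.
  have r12 : r1 = 0 /\ r2 = 0.
    move: re im; rewrite rz !mul0r => re /esym/eqP.
    rewrite mulf_eq0 => /orP[/eqP r2z|/eqP sd].
      by move: re; rewrite r2z mul0r addr0.
    have dz : d = 0.
      apply/eqP; rewrite eq_le d0 andbT leNgt; apply/negP => dgt.
      by have := @sin_gt0_pi R d; rewrite dgt dpi sd ltxx => /(_ isT).
    by move: re; rewrite dz cos0 mulr1; lra.
  exists 0, x; split; rewrite ?lexx//.
  by case: r12 => -> ->; rewrite !mul0r addr0.
have rgt : 0 < r by rewrite lt_def rn0.
have td : t <= d.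
  rewrite leNgt; apply/negP => dt.
  have sN : r * sin (t - d) = - (r1 * sin d).
    rewrite sinB mulrBr !mulrA re im; ring.
  have r1sd : 0 <= r1 * sin d by rewrite mulr_ge0.
  have [tdpi|tdpi] := ltP (t - d) pi.
    have : 0 < sin (t - d) by apply: sin_gt0_pi; lra.
    by move=> /(mulr_gt0 rgt); lra.
  (* In this boundary case both vectors point along the positive real axis and their sum along the
     negative one. *)
  have [tE dE] : t = pi /\ d = 0 by split; lra.
  by move: re; rewrite tE dE cospi cos0; lra.
exists r, (x + t); split => //.
- by rewrite /d in td; lra.
- by rewrite sumE cisD wr; ring.
- by move=> rz; rewrite rz eqxx in rn0.
Qed.

End Polar.

(** * Phases for the normalised recurrence $u_n=u_{n-l}+re^{ib}u_{n-k}$ *)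

Section Phases.
Context {R : realType} {k l : nat} {b r : R} {u : int -> R[i]} {Z : int -> Prop}.
Hypotheses (hl : (0 < l)%N) (hlk : (l < k)%N) (b0 : 0 <= b)
  (bpi : b *+ l < pi) (r0 : 0 < r).
Hypothesis urec : forall n : int, 1 <= n ->
  u n = u (n - l%:Z) + r%:C * cis b * u (n - k%:Z).
Hypothesis u_0 : u 0 = 1.
Hypothesis u_init : forall m : int, 1 - k%:Z <= m <= -1 -> u m = 0.
Hypothesis Z_init : forall m : int, 1 - k%:Z <= m <= -1 -> Z m.
Hypothesis Z_closed : forall n : int, 1 <= n -> Z (n - l%:Z) -> Z (n - k%:Z) -> Z n.

(** Imposed at every $m\le N$, without a lower bound, so that chains of steps may run below
    $1-k$. *)
Let phase_le (N : int) (phi : int -> R) :=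
  forall m : int, m <= N -> phi (m - l%:Z) <= phi m /\ phi m <= phi (m - k%:Z) + b.

(* Step down by k (l - 1) times, then up by l (k - 1) times: the net
   displacement is k - l. *)
Lemma phase_gap {N phi n} : phase_le N phi -> n <= N + 1 ->
  phi (n - k%:Z) <= phi (n - l%:Z) + b *+ l.-1.
Proof.
move=> phiP nN.
have down (m : int) j : m <= N -> phi m <= phi (m - (k * j)%N%:Z) + b *+ j.
  move=> mN; elim: j => [|j IH]; first by rewrite muln0 subr0 mulr0n addr0.
  have [|_] := phiP (m - (k * j)%N%:Z); first by lia.
  rewrite (_ : m - (k * j)%N%:Z - k%:Z = m - (k * j.+1)%N%:Z); last by lia.
  by rewrite mulrS => h; move: (b *+ j) IH => c IH; lra.
have up (m : int) j : m <= N -> phi (m - (l * j)%N%:Z) <= phi m.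
  move=> mN; elim: j => [|j IH]; first by rewrite muln0 subr0.
  have [|+ _] := phiP (m - (l * j)%N%:Z); first by lia.
  rewrite (_ : m - (l * j)%N%:Z - l%:Z = m - (l * j.+1)%N%:Z); last by lia.
  by lra.
have nk : n - k%:Z <= N by lia.
have nl : n - l%:Z <= N by lia.
have := down _ l.-1 nk; have := up _ k.-1 nl.
rewrite (_ : n - l%:Z - (l * k.-1)%N%:Z = n - k%:Z - (k * l.-1)%N%:Z); last by nia.
by move: (b *+ l.-1) => c; lra.
Qed.

(** Induction on $N$, the next angle coming from [cone_angle]. A vanishing term also receives a
    phase; [Z] records its vanishing and stands for $P_m=0$ identically. *)
Lemma phases (N : nat) : exists phi, phase_le N%:Z phi /\
  forall m : int, 1 - k%:Z <= m <= N%:Z ->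
    exists rho, [/\ 0 <= rho, u m = rho%:C * cis (phi m) & rho = 0 -> Z m].
Proof.
elim: N => [|N [phi [phiP uP]]].
  exists (fun=> 0); split; first by move=> m _ /=; rewrite add0r lexx.
  move=> m /andP[m1 m0]; have [->|mN0] := eqVneq m 0.
    by exists 1; split => //; [rewrite cis0 u_0 mulr1|move/eqP; rewrite oner_eq0].
  have mI : 1 - k%:Z <= m <= -1 by lia.
  by exists 0; split=> // [|_]; [rewrite mul0r u_init|exact: Z_init].
pose n := N.+1%:Z.
have n1 : 1 <= n by rewrite /n; lia.
have ne m (j : nat) : m <= n -> (0 < j)%N -> m - j%:Z != n.
  by move=> mn j0; rewrite lt_eqF// (lt_le_trans _ mn)// gtrBl.
have le_N m : m <= n -> m != n -> m <= N%:Z.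
  by move=> mn mn'; rewrite -ltzD1 (_ : N%:Z + 1 = n) ?lt_neqAle ?mn' // /n intS addrC.
have k0 : (0 < k)%N by apply: leq_trans hlk.
have [] := uP (n - l%:Z); first by rewrite /n; lia.
move=> r1 [r10 u1 Z1]; have [] := uP (n - k%:Z); first by rewrite /n; lia.
move=> r2 [r20 u2 Z2].
have gap : phi (n - k%:Z) <= phi (n - l%:Z) + b *+ l.-1.
  by apply: phase_gap phiP _; rewrite /n; lia.
have bl : b *+ l.-1 + b = b *+ l by rewrite -mulrSr prednK.
(* Both indices are compared with $n-k-l$. *)
have le1 : phi (n - l%:Z) <= phi (n - k%:Z) + b.
  have [|_ h1] := phiP (n - l%:Z); first by rewrite /n; lia.
  have [|h2 _] := phiP (n - k%:Z); first by rewrite /n; lia.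
  by apply: le_trans h1 _; rewrite lerD2r addrAC.
(* The summands are at most $lb<\pi$ apart: [gap] gives $(l-1)b$, the factor [cis b] one more
   $b$. *)
have lt1 : phi (n - k%:Z) + b < phi (n - l%:Z) + pi.
  by move: (b *+ l.-1) (b *+ l) gap bl bpi => c c'; lra.
have rr2 : 0 <= r * r2 by rewrite mulr_ge0// ltW.
have [rho [x [rho0 /andP[x1 x2] rhoE rhoZ]]] := cone_angle r10 rr2 le1 lt1.
(* The inequalities at $m\le N$ involve only indices up to $m$, so changing the phase at $n$ keeps
   them. *)
pose phi' m := if m == n then x else phi m.
have phi'E m : m != n -> phi' m = phi m by rewrite /phi' => /negPf->.
have phi'n : phi' n = x by rewrite /phi' eqxx.
exists phi'; split.
  move=> m mN; rewrite !(phi'E (m - _)) ?ne//.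
  have [->|mn] := eqVneq m n; first by rewrite phi'n.
  by rewrite phi'E//; apply/phiP/le_N.
move=> m /andP[m1 mN]; have [->|mn] := eqVneq m n; last first.
  by rewrite phi'E//; apply: uP; rewrite m1 le_N.
exists rho; rewrite phi'n -rhoE; split => //.
  rewrite urec//.
  by rewrite u1 u2 cisD rmorphM /=; ring.
move=> /rhoZ[/Z1 z1 /eqP]; rewrite mulf_eq0 gt_eqF//= => /eqP/Z2 z2.
by apply: Z_closed.
Qed.

Lemma recurrence_neq0 (n : nat) : u n%:Z = 0 -> Z n%:Z.
Proof.
have [phi [_ /(_ n%:Z)]] := phases n; case; first by lia.
move=> rho [_ -> rhoZ] /eqP; rewrite mulf_eq0 (negPf (cis_neq0 _)) orbF.
by rewrite eq_complex /= eqxx andbT => /eqP.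
Qed.

End Phases.

(** * General complex coefficients: non-vanishing and symmetry *)

Lemma trinomial_neq0_upper {R : realType} {k l : nat} {a b : R[i]}
    {p : int -> R[i]} {Z : int -> Prop}
    (hl : (0 < l)%N) (hlk : (l < k)%N) (hkl : coprime k l)
    (a0 : a != 0) (b0 : b != 0) (im : 0 < complex.Im (a ^+ l / b ^+ k))
    (prec : forall n : int, 1 <= n -> p n = b * p (n - l%:Z) + a * p (n - k%:Z))
    (p_0 : p 0 = 1) (p_init : forall m : int, 1 - k%:Z <= m <= -1 -> p m = 0)
    (Z_init : forall m : int, 1 - k%:Z <= m <= -1 -> Z m)
    (Z_closed : forall n : int, 1 <= n -> Z (n - l%:Z) -> Z (n - k%:Z) -> Z n)
    (n : nat) : p n%:Z = 0 -> Z n%:Z.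
Proof.
have [s [g [s0 /andP[g0 gpi] wE]]] := polar_upper (ltW im).
have imE : s * sin g = complex.Im (a ^+ l / b ^+ k) by rewrite wE /=; ring.
have sgt : 0 < s.
  by rewrite lt_def s0 andbT; apply: contraTneq im => s00; rewrite -imE s00 mul0r ltxx.
have glt : g < pi.
  by rewrite lt_def gpi andbT; apply: contraTneq im => gE; rewrite -imE -gE sinpi mulr0 ltxx.
have l0 : l%:R != 0 :> R by rewrite pnatr_eq0 -lt0n.
(* Chosen so that $(re^{ic})^l=a^l/b^k$, that is $(a/(re^{ic}))^l=b^k$; coprimality then gives $x$
   with $b=x^l$ and $a=x^k re^{ic}$, and dividing $p_m$ by $x^m$ normalises the recurrence. *)
pose r := s `^ l%:R^-1; pose c := g / l%:R.
have r0 : 0 < r by apply: powR_gt0.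
have rl : r ^+ l = s by rewrite -powR_mulrn ?ltW// -powRrM mulVf// powRr1 ?ltW.
have cl : c *+ l = g by rewrite -mulr_natr mulfVK.
have rc0 : r%:C * cis c != 0 by rewrite mulf_neq0 ?cis_neq0// eq_complex /= eqxx andbT gt_eqF.
have rcl : (r%:C * cis c) ^+ l = a ^+ l / b ^+ k.
  by rewrite wE exprMn -cisMn cl -rl rmorphXn.
have [x [xk xl]] : exists x, a / (r%:C * cis c) = x ^+ k /\ b = x ^+ l.
  apply: (coprime_exp_eq hkl) => //; first by rewrite mulf_neq0 ?invr_eq0.
  by rewrite expr_div_n rcl invf_div mulrC divfK// expf_neq0.
have x0 : x != 0 by apply: contraNneq b0 => x00; rewrite xl x00 expr0n; case: (l) hl.
have aE : a = x ^+ k * (r%:C * cis c) by rewrite -xk divfK.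
pose u m := p m / x ^ m.
have uS m (j : nat) : p (m - j%:Z) / x ^ m = u (m - j%:Z) / x ^+ j.
  by rewrite /u -mulrA -invfM -[x ^+ j]/(x ^ j%:Z) -expfzDr// subrK.
move=> pn0; apply: (@recurrence_neq0 R k l c r u Z) => //.
- by rewrite divr_ge0.
- by rewrite cl.
- move=> m m1; rewrite {1}/u prec// mulrDl -!mulrA !uS {1}xl aE.
  have xj j : x ^+ j != 0 by rewrite expf_neq0.
  by field; rewrite !xj.
- by rewrite /u p_0 expr0z divr1.
- by move=> m mI; rewrite /u p_init// mul0r.
- by rewrite /u pn0 mul0r.
Qed.

(** Conjugating $a$, $b$ and the sequence flips the sign of the imaginary part and preserves
    vanishing, so [Z] stays the same. *)
Lemma trinomial_neq0 {R : realType} {k l : nat} {a b : R[i]}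
    {p : int -> R[i]} {Z : int -> Prop}
    (hl : (0 < l)%N) (hlk : (l < k)%N) (hkl : coprime k l)
    (a0 : a != 0) (b0 : b != 0) (im : complex.Im (a ^+ l / b ^+ k) != 0)
    (prec : forall n : int, 1 <= n -> p n = b * p (n - l%:Z) + a * p (n - k%:Z))
    (p_0 : p 0 = 1) (p_init : forall m : int, 1 - k%:Z <= m <= -1 -> p m = 0)
    (Z_init : forall m : int, 1 - k%:Z <= m <= -1 -> Z m)
    (Z_closed : forall n : int, 1 <= n -> Z (n - l%:Z) -> Z (n - k%:Z) -> Z n)
    (n : nat) : p n%:Z = 0 -> Z n%:Z.
Proof.
have [im0|im0|/eqP] := ltgtP 0 (complex.Im (a ^+ l / b ^+ k));
  last by rewrite eq_sym (negPf im).
  exact: trinomial_neq0_upper im0 prec p_0 p_init Z_init Z_closed n.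
move=> pn0; apply: (@trinomial_neq0_upper R k l (conjc a) (conjc b) (conjc \o p) Z) => //=.
- by rewrite conjc_eq0.
- by rewrite conjc_eq0.
- by rewrite -!rmorphXn -fmorphV -rmorphM; case: (_ / _) im0 => x y /=; rewrite oppr_gt0.
- by move=> m m1; rewrite prec// rmorphD !rmorphM.
- by rewrite p_0 rmorph1.
- by move=> m mI; rewrite p_init// rmorph0.
- by rewrite pn0 rmorph0.
Qed.

(* The conjugate-linear map x |-> s * x^* plays the role of complex
   conjugation once the trinomial is rescaled to have real coefficients. *)
Lemma trinomial_symmetry {R : realType} {k l : nat} {a b : R[i]} :
  (0 < k)%N -> coprime k l -> a != 0 -> b != 0 -> complex.Im (a ^+ l / b ^+ k) = 0 ->
  exists s : R[i], `|s| = 1 /\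
    forall x, a * x ^+ k + b * x ^+ l = 1 ->
      a * (s * conjc x) ^+ k + b * (s * conjc x) ^+ l = 1.
Proof.
move=> k0 kl a0 b0 im.
have wR : conjc (a ^+ l / b ^+ k) = a ^+ l / b ^+ k.
  by case: (_ / _) im => x y /= ->; rewrite oppr0.
have ca0 : conjc a != 0 by rewrite conjc_eq0.
have cb0 : conjc b != 0 by rewrite conjc_eq0.
(* Realness of $w$ says exactly that $(\bar a/a)^l=(\bar b/b)^k$. *)
have [s [sk sl]] : exists s, conjc a / a = s ^+ k /\ conjc b / b = s ^+ l.
  apply: (coprime_exp_eq kl); try by rewrite mulf_neq0 ?invr_eq0.
  move: wR; rewrite rmorphM fmorphV !rmorphXn => wR.
  apply: (@mulIf _ (a ^+ l / conjc b ^+ k)).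
    by rewrite mulf_neq0 ?invr_eq0 ?expf_neq0.
  rewrite !expr_div_n mulrA divfK ?expf_neq0// wR; field.
  by rewrite !expf_neq0.
exists s; split.
  apply/eqP; rewrite -(@pexpr_eq1 _ _ k) ?normr_ge0//.
  by rewrite -normrX -sk normrM normfV normcJ divff// normr_eq0.
(* By the choice of $s$, $a(s\bar x)^k=\overline{ax^k}$, and likewise for $b$ and $l$. *)
move=> x xE; rewrite !exprMn !mulrA -sk -sl.
rewrite ![_ * (_ / _)]mulrC !divfK//.
by rewrite -!rmorphXn -!rmorphM -rmorphD /= xE rmorph1.
Qed.

(** * The zeros of $D(t;z_0)$ and the case distinction *)

Lemma mem_lists_zeros {F : fieldType} {t : seq F} {p : {poly F}} :
  p != 0 -> lists_zeros t p -> t =i root p.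
Proof.
move=> p0 tP x; rewrite -has_pred1 has_count tP.
by rewrite mup_geq// expr1 dvdp_XsubCl.
Qed.

Theorem theorem1p5 (R : realType) (k l : nat) (A B : {poly R[i]})
    (P : int -> {poly R[i]}) (z0 : R[i])
    (hl : (1 <= l)%N) (hlk : (l < k)%N) (hkl : coprime k l)
    (hA : A != 0) (hB : B != 0) (hAB : (1 <= (size (A * B)%R).-1)%N)
    (hP : trinomial_recurrence k l A B P)
    (hz0 : (zeros_of_sequence P `\` zeros A) z0)
    (t : k.-tuple R[i]) (ht : lists_zeros t (denominator k l A B z0)) :
  exists i j : 'I_k,
    i != j /\
    (tnth t i / tnth t j \is Num.real \/ `|tnth t i / tnth t j| = 1).
Proof.
case: hP => Prec P_0 P_init; case: hz0 => -[f [f0 [n n_ge0 fE]] fz] Az0; subst f.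
case: n n_ge0 f0 fz => // n _ Pn0 Pnz0.
set D := denominator k l A B z0 in ht.
have a0 : - A.[z0] != 0 by rewrite oppr_eq0; apply/negP => /Az0.
have k0 : (0 < k)%N by exact: leq_trans hlk.
have k1 : (1 < k)%N by exact: leq_ltn_trans hlk.
have DE x : D.[x] = A.[z0] * x ^+ k + B.[z0] * x ^+ l + 1.
  by rewrite /D /denominator !hornerE.
have D0 : D.[0] = 1 by rewrite DE !expr0n !gtn_eqF// !mulr0 !add0r.
have Dn0 : D != 0 by apply: contra_eq_neq D0 => ->; rewrite horner0 eq_sym oner_eq0.
have tE x : (x \in t) = (D.[x] == 0) by rewrite (mem_lists_zeros Dn0 ht).
have tn0 i : tnth t i != 0.
  by apply: contraTneq (mem_tnth i t) => ->; rewrite tE D0 oner_eq0.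
have rootE x : (D.[x] == 0) = (- A.[z0] * x ^+ k + - B.[z0] * x ^+ l == 1).
  by rewrite DE !mulNr -opprD eqr_oppLR addr_eq0.
pose i0 := Ordinal k0; pose i1 := Ordinal k1.
have [b0|b0] := eqVneq B.[z0] 0.
  exists i0, i1; split => //; right.
  have rk i : tnth t i ^+ k = (- A.[z0])^-1.
    have := mem_tnth i t; rewrite tE rootE b0 oppr0 mul0r addr0 => /eqP rE.
    by apply: (mulfI a0); rewrite rE divff.
  rewrite normrM normfV; apply/eqP; rewrite -(@pexpr_eq1 _ _ k)//; last first.
    by rewrite mulr_ge0 ?invr_ge0.
  by rewrite -normfV -normrM -normrX expr_div_n !rk divff ?invr_eq0// normr1.
have nb0 : - B.[z0] != 0 by rewrite oppr_eq0.
have [im|im] := eqVneq (complex.Im ((- A.[z0]) ^+ l / (- B.[z0]) ^+ k)) 0; last first.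
  have Pn : P n = 0.
    have PS m : 1 <= m -> P m = - B * P (m - l%:Z) + - A * P (m - k%:Z).
      move=> m1; apply/eqP; rewrite -subr_eq0 -(Prec m m1); apply/eqP; ring.
    (* With [Z] read as $P_m=0$ identically, the zero of $P_n$ at $z_0$ forces $P_n=0$, against
       [Pn0]. *)
    apply: (trinomial_neq0 hl hlk hkl a0 nb0 im
      (p := fun m => (P m).[z0]) (Z := fun m => P m = 0)) => //=.
    - by move=> m m1; rewrite PS// !hornerE.
    - by rewrite P_0 hornerE.
    - by move=> m mI; rewrite P_init// horner0.
    - by move=> m m1 P1 P2; rewrite PS// P1 P2 !mulr0 addr0.
    - exact/eqP.
  by move: Pn0; rewrite /= Pn eqxx.
have [s [s1 sP]] := trinomial_symmetry k0 hkl a0 nb0 im.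
have [fixed|] := boolP [forall i, s * conjc (tnth t i) == tnth t i].
  exists i0, i1; split => //; left.
  have s0 : s != 0 by rewrite -normr_gt0 s1.
  (* The factor $s$ cancels in a ratio of two fixed zeros, which is therefore its own conjugate. *)
  have cE i : conjc (tnth t i) = tnth t i / s.
    by rewrite -{2}(eqP (forallP fixed i)) mulrAC divff// mul1r.
  have : conjc (tnth t i0 / tnth t i1) = tnth t i0 / tnth t i1.
    by rewrite rmorphM fmorphV /= !cE invf_div mulrA divfK.
  by case: (_ / _) => x y /eqP; rewrite complex_real eq_complex /= eqNr => /andP[_].
rewrite negb_forall => /existsP[j js].
(* The image of the moved zero is listed too, necessarily at another index, and has the same
   modulus. *)
have : s * conjc (tnth t j) \in t.
  by rewrite tE rootE sP//; apply/eqP; rewrite -rootE -tE mem_tnth.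
case/tnthP => i iE; exists i, j; split.
  by apply: contraNneq js => ij; rewrite iE ij.
by right; rewrite -iE !normrM s1 mul1r normcJ normfV divff// normr_eq0.
Qed.
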